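(* Let $M\cong\mathbb{Z}^d$ be a lattice with dual lattice $N$, let $S\subset M$ be a finitely generated semigroup (containing $0$) with $S+(-S)=M$ and $S\cap(-S)=\{0\}$, let $\check\sigma\subset M\otimes\mathbb{R}$ be the cone generated by $S$ and suppose $S=\check\sigma\cap M$. Let $\sigma\subset N\otimes\mathbb{R}\cong\mathbb{R}^d$ be the dual cone of $\check\sigma$. Let $\{s_1,\ldots,s_{d+p}\}$ be a system of generators of $S$ and suppose that $V=\mathrm{Spec}\,\mathbb{C}[S]$, embedded in $\mathbb{C}^{d+p}$ by $\varepsilon:\mathbb{C}[x_1,\ldots,x_{d+p}]\to\mathbb{C}[S]$, $x_k\mapsto\chi^{s_k}$, is a complete intersection whose ideal $\ker\varepsilon$ is generated by $p$ binomials $h^i=\underline x^{\underline{\alpha^i}}-\underline x^{\underline{\beta^i}}$, $1\le i\le p$, where $\underline x^{\underline{\alpha^i}}$ and $\underline x^{\underline{\beta^i}}$ have no variable in common. Let $\tau^*\subset\mathbb{R}^{d+p}_{\ge0}$ be the intersection of the dual cones of the segments $[\underline{\alpha^i},\underline{\beta^i}]$, $1\le i\le p$, i.e. $$\tau^*=\Bigl\{\mu\in\mathbb{R}^{d+p}_{\ge0}\ \Big|\ \sum_{k=1}^{d+p}(\alpha^i_k-\beta^i_k)\mu^k=0,\ 1\le i\le p\Bigr\}.$$ Then the cones $\sigma$ and $\tau^*$ are isomorphic via $$\theta:\nu\longmapsto(\langle s_1,\nu\rangle,\ldots,\langle s_{d+p},\nu\rangle),$$ and under this isomorphism one has $$P^{\underline\nu}_V(\underline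 t)=\mathcal{P}^{\underline\mu}_V(\underline t)$$ for every finite set $\underline\nu=\{\nu_1,\ldots,\nu_r\}$ of primitive elements of $\sigma\cap N$ for which these Poincaré series are defined (i.e. the dimensions occurring in them are finite), where $\underline\mu=\{\mu_1,\ldots,\mu_r\}$ with $\mu_j=\theta(\nu_j)$.
   Context: A primitive element $n\in\sigma\cap N$ defines a valuation by $\nu(\sum_{m\in F}a_m\chi^m)=\min\{\langle m,n\rangle\mid m\in F,\ a_m\ne0\}$. An integral element $\mu=(\mu^1,\ldots,\mu^{d+p})$ of $\tau^*$ defines the monomial valuation $\mu(\underline x^{\lambda})=\langle\lambda,\mu\rangle=\sum_k\lambda_k\mu^k$ on the ambient space, taking the minimum over the monomials in the support. Let $o$ denote the origin of $\mathbb{C}^{d+p}$, which lies on $V$, and $\mathcal{O}_{V,o}=\mathcal{O}_{\mathbb{C}^{d+p},o}/(h^1,\ldots,h^p)$; elements of $\mathcal{O}_{V,o}$ are convergent series in the $\chi^s$, $s\in S$. For a decreasing family of ideals $K(\underline v)\subset\mathcal{O}_{V,o}$, $\underline v\in\mathbb{Z}^r$, with all $\dim_{\mathbb{C}}K(\underline v)/K(\underline v+\underline1)$ finite ($\underline1=(1,\ldots,1)$), its Poincaré series is $$\frac{\prod_{j=1}^r(t_j-1)}{t_1\cdots t_r-1}\sum_{\underline v\in\mathbb{Z}^r}\dim_{\mathbb{C}}\bigl(K(\underline v)/K(\underline v+\underline1)\bigr)\underline t^{\underline v},$$ where the sum is first multiplied by $\prod_j(t_j-1)$, giving a formal power series,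 and then divided by $t_1\cdots t_r-1$ in $\mathbb{Z}[[t_1,\ldots,t_r]]$. $P^{\underline\nu}_V$ is the Poincaré series for $K(\underline v)=\{g\in\mathcal{O}_{V,o}\mid\nu_j(g)\ge v_j,\ 1\le j\le r\}$. $\mathcal{P}^{\underline\mu}_V$ (the Poincaré series of the embedded filtration) is the Poincaré series for $K(\underline v)=$ the image in $\mathcal{O}_{V,o}$ of $\{g\in\mathcal{O}_{\mathbb{C}^{d+p},o}\mid\mu_j(g)\ge v_j,\ 1\le j\le r\}+(h^1,\ldots,h^p)$. *)

(* Defs.v *)
From HB Require Import structures.
From mathcomp Require Import all_boot all_order all_algebra.
From mathcomp Require Import complex.
From mathcomp Require Import boolp classical_sets functions cardinality fsbigop.
From mathcomp Require Import reals ereal esum.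
From mathcomp Require mpoly.

(* The notations of mpoly clash with those of MathComp-Analysis. *)
Import -(notations) mpoly.

Set Implicit Arguments.
Unset Strict Implicit.
Unset Printing Implicit Defensive.

Import Order.TTheory GRing.Theory Num.Theory.

Local Open Scope classical_set_scope.
Local Open Scope ring_scope.

(* The lattice M is Z^d; its dual N is again Z^d, paired with M by the standard
   bilinear form.  Both are embedded in R^d by [toR]. *)
Section Cones.
Variable R : realType.

Definition toR d (m : 'rV[int]_d) : 'rV[R]_d := map_mx intr m.

Definition pairing d (x y : 'rV[R]_d) : R := \sum_(i < d) x 0 i * y 0 i.

Definition cone_of d (S : set 'rV[int]_d) : set 'rV[R]_d :=
  [set x | exists (q : nat) (c : 'I_q -> R) (m : 'I_q -> 'rV[int]_d),
     (forall i, 0 <= c i /\ S (m i)) /\ x = \sum_(i < q) c i *: toR (m i)].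

Definition dual_cone d (A : set 'rV[R]_d) : set 'rV[R]_d :=
  [set y | forall x, A x -> 0 <= pairing x y].

Definition primitive d (u : 'rV[int]_d) : Prop :=
  forall (k : int) (u' : 'rV[int]_d), u = k *: u' -> k = 1 \/ k = -1.

Definition theta d n (s : 'I_n -> 'rV[int]_d) (y : 'rV[R]_d) : 'rV[R]_n :=
  \row_k pairing (toR (s k)) y.

Definition tau_star n p (alpha beta : 'I_p -> multinom n) : set 'rV[R]_n :=
  [set mu | (forall k, 0 <= mu 0 k) /\
     forall i, \sum_(k < n) ((alpha i k)%:R - (beta i k)%:R) * mu 0 k = 0].

Definition cone_iso m n (A : set 'rV[R]_m) (B : set 'rV[R]_n)
    (f : 'rV[R]_m -> 'rV[R]_n) : Prop :=
  linear f /\ set_bij A B f.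

End Cones.

Arguments cone_of R [d] S.
Arguments theta R [d n] s y.
Arguments tau_star R [n p] alpha beta.

(* The exponent of the image of x^l under x_k |-> chi^(s_k). *)
Definition weight d n (s : 'I_n -> 'rV[int]_d) (l : multinom n) : 'rV[int]_d :=
  \sum_(k < n) s k *+ l k.

Section Germs.
Variable R : realType.
Local Notation C := R[i].

(* A formal power series is identified with its family of coefficients. *)
Definition pseries n := multinom n -> C.

Definition poly_series n (f : mpoly n C) : pseries n := fun l => mcoeff l f.

Definition mul_series n (f g : pseries n) : pseries n := fun l =>
  \sum_(k : bmultinom n (mdeg l).+1 | lem k l) f k * g (mnm_sub l k).

(* O_{C^n,o}: the series converging absolutely on some polydisc around o. *)
Definition convergent n : set (pseries n) :=
  [set f | exists2 rho : R, 0 < rho &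
     summable [set: multinom n]
       (fun l => (complex.Re `|f l| * rho ^+ mdeg l)%:E)].

(* The image of \sum_l f_l x^l under x_k |-> chi^(s_k), as the family of its
   coefficients on the chi^m.  For a polynomial f this is epsilon(f) in C[S];
   for f in O_{C^n,o} it is the expansion in the chi^m of the class of f in
   O_{V,o}.  If all s_k are nonzero, i.e. if o lies on V, then for S pointed
   only finitely many l have a given weight. *)
Definition expansion d n (s : 'I_n -> 'rV[int]_d) (f : pseries n) :
    'rV[int]_d -> C :=
  fun m => \sum_(l \in [set l | weight s l = m]) f l.

Definition ker_eps d n (s : 'I_n -> 'rV[int]_d) : set (mpoly n C) :=
  [set f | forall m, expansion s (poly_series f) m = 0].

Definition binomial_of n (a b : multinom n) : mpoly n C :=
  mpolyX C a - mpolyX C b.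

Definition poly_ideal n p (h : 'I_p -> mpoly n C) : set (mpoly n C) :=
  [set f | exists q : 'I_p -> mpoly n C, f = \sum_(i < p) q i * h i].

Definition germ_ideal n p (h : 'I_p -> mpoly n C) : set (pseries n) :=
  [set f | exists2 q : 'I_p -> pseries n, (forall i, convergent (q i)) &
     f = \sum_(i < p) mul_series (q i) (poly_series (h i))].

(* A subset of O_{V,o} = O_{C^n,o}/(h) is represented by its full preimage in
   O_{C^n,o}; this is the preimage of the image of A in O_{V,o}. *)
Definition image_in_V n p (h : 'I_p -> mpoly n C) (A : set (pseries n)) :
    set (pseries n) :=
  [set f | exists a b, [/\ A a, germ_ideal h b & f = a + b]].

(* The least weight of an index in the support of a, +oo if a = 0. *)
Definition order_of (I : Type) (w : I -> R) (a : I -> C) : \bar R :=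
  ereal_inf [set (w i)%:E | i in [set i | a i != 0]].

Definition toric_val d (y : 'rV[R]_d) (a : 'rV[int]_d -> C) : \bar R :=
  order_of (fun m => pairing (toR R m) y) a.

Definition monomial_val n (mu : 'rV[R]_n) (f : pseries n) : \bar R :=
  order_of (fun l : multinom n => \sum_(k < n) (l k)%:R * mu 0 k) f.

Definition K_toric d n p r (s : 'I_n -> 'rV[int]_d) (h : 'I_p -> mpoly n C)
    (nu : 'I_r -> 'rV[R]_d) (v : 'rV[int]_r) : set (pseries n) :=
  image_in_V h [set g | convergent g /\
    forall j, (((v 0 j)%:~R)%:E <= toric_val (nu j) (expansion s g))%E].

Definition K_embedded n p r (h : 'I_p -> mpoly n C)
    (mu : 'I_r -> 'rV[R]_n) (v : 'rV[int]_r) : set (pseries n) :=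
  image_in_V h [set g | convergent g /\
    forall j, (((v 0 j)%:~R)%:E <= monomial_val (mu j) g)%E].

End Germs.

Arguments ker_eps R [d n] s.

Section Poincare.
Variables (F : fieldType) (E : lmodType F).

Definition quot_basis (A B : set E) q (e : 'I_q -> E) : Prop :=
  [/\ forall i, A (e i),
      forall c : 'I_q -> F, B (\sum_(i < q) c i *: e i) -> forall i, c i = 0
    & forall a, A a -> exists c : 'I_q -> F, B (a - \sum_(i < q) c i *: e i)].

Definition quot_dims (A B : set E) : set nat :=
  [set q | exists e : 'I_q -> E, quot_basis A B e].

Definition quot_findim (A B : set E) : Prop := quot_dims A B !=set0.

Definition quot_dim (A B : set E) : nat := xget 0%N (quot_dims A B).

Variable r : nat.

Definition mnm_row (m : multinom r) : 'rV[int]_r := \row_j (m j)%:Z.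

(* Product of a polynomial in t_1, ..., t_r and a series infinite in both
   directions, \sum_(v in Z^r) L v t^v. *)
Definition mul_laurent (f : mpoly r int) (L : 'rV[int]_r -> int) :
    'rV[int]_r -> int :=
  fun v => \sum_(m <- msupp f) mcoeff m f * L (v - mnm_row m).

Definition poincare_defined (K : 'rV[int]_r -> set E) : Prop :=
  forall v, quot_findim (K v) (K (v + const_mx 1)).

Definition dim_series (K : 'rV[int]_r -> set E) : 'rV[int]_r -> int :=
  fun v => (quot_dim (K v) (K (v + const_mx 1)))%:Z.

Definition poincare_numerator (K : 'rV[int]_r -> set E) : 'rV[int]_r -> int :=
  mul_laurent (\prod_(j < r) (mpolyX int (mnm1 j) - 1)) (dim_series K).

(* Division by t_1...t_r - 1 in Z[[t_1, ..., t_r]], r > 0: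
   1 / (t_1...t_r - 1) = - \sum_k (t_1...t_r)^k. *)
Definition div_T1 (Q : 'rV[int]_r -> int) : multinom r -> int := fun m =>
  - \sum_(k < (mdeg m).+1 | [forall j, (k <= m j)%N])
      Q (mnm_row m - const_mx k%:Z).

Definition poincare (K : 'rV[int]_r -> set E) : multinom r -> int :=
  div_T1 (poincare_numerator K).

End Poincare.

(* Main.v *)
(* The two filtrations coincide, K_toric v = K_embedded v for every v; the
   equality of the Poincare series follows.

   An exponent l of weight m satisfies <l, theta nu> = <m, nu>, which gives
   K_embedded v <= K_toric v.  Conversely, split a germ g by weights and drop
   from it the homogeneous parts with zero image in C[S].  What is left has the
   same image and only monomials of the required order, so it remains to see
   that the dropped part, a convergent series with zero expansion, lies in the
   ideal of the convergent power series ring generated by the h i.  Each of its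
   homogeneous parts does, by the hypothesis on ker eps; the sum of the
   resulting quotients converges because the pairs of exponents of equal weight
   form a finitely generated monoid, so that x^l - x^l' can be written with
   quotients whose degrees and coefficients are linearly bounded in the degree
   of l.

   For the cones, a point mu of tau^* extends to the exponents, and takes equal
   values on exponents of equal weight; so it factors through the weight. *)

Require Import Defs.
From HB Require Import structures.
From mathcomp Require Import all_boot all_order all_algebra.
From mathcomp Require Import complex.
From mathcomp Require Import boolp classical_sets functions cardinality fsbigop.
From mathcomp Require Import reals ereal esum.
From mathcomp Require exp.
From mathcomp Require mpoly.
Import -(notations) mpoly.

Set Implicit Arguments.
Unset Strict Implicit.
Unset Printing Implicit Defensive.

Import Order.TTheory GRing.Theory Num.Theory.

Local Open Scope classical_set_scope.
Local Open Scope ring_scope.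

(** * Convergence as geometric growth of the coefficients *)

Section GeometricGrowth.
Variable R : realType.

(** Natural constants keep the later estimates in [nat]. *)
Definition geometric_growth n (f : pseries R n) : Prop :=
  exists M K : nat, forall l, `|f l| <= (M * K ^ mdeg l)%:R.

Lemma sum_geometric_half_le2 (D : nat) :
  \sum_(j < D) (2^-1 : R) ^+ j <= 2.
Proof.
have: (1 - 2^-1 : R) * \sum_(j < D) 2^-1 ^+ j = 1 - 2^-1 ^+ D.
  by rewrite -opprB mulNr -subrX1 opprB.
move=> E; have h : 1 - 2^-1 = 2^-1 :> R.
  by rewrite {1}[1]splitr mul1r addrK.
move: E; rewrite h => E; rewrite -[leLHS](mulVKf (_ : (2 : R) != 0)) ?pnatr_eq0//.
rewrite E ler_piMr// lerBlDr lerDl exprn_ge0// invr_ge0//.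
Qed.

(** The exponents in [r] lie in a box, and the sum over the box is a product of [n] geometric sums,
    each at most 2. *)
Lemma sum_half_mdeg_le n (r : seq (multinom n)) :
  uniq r -> \sum_(l <- r) (2^-1 : R) ^+ mdeg l <= 2 ^+ n.
Proof.
move=> ur; pose D := (\max_(l <- r) mdeg l)%N.
pose G (l : multinom n) : {ffun 'I_n -> 'I_D.+1} := [ffun k => inord (l k)].
have Gr l k : l \in r -> G l k = l k :> nat.
  move=> lr; rewrite ffunE inordK// ltnS.
  apply: (@leq_trans (mdeg l)); first by rewrite mdegE (bigD1 k)//= leq_addr.
  by rewrite /D (big_rem l)//= leq_maxl.
have -> : \sum_(l <- r) (2^-1 : R) ^+ mdeg l =
    \sum_(g <- map G r) \prod_(k < n) (2^-1 : R) ^+ g k.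
  rewrite big_map big_seq [RHS]big_seq; apply: eq_bigr => l lr.
  by rewrite mdegE expr_sum; apply: eq_bigr => k _; rewrite Gr.
rewrite big_uniq /=; last first.
  rewrite map_inj_in_uniq// => l l' lr l'r E; apply/mnmP => k.
  by rewrite -(Gr l)// -(Gr l')// E.
apply: (@le_trans _ _
    (\sum_(g : {ffun 'I_n -> 'I_D.+1}) \prod_(k < n) (2^-1 : R) ^+ g k)).
  rewrite big_mkcond; apply: ler_sum => g _; case: ifP => // _.
  by apply: prodr_ge0 => k _; rewrite exprn_ge0// invr_ge0.
rewrite -(bigA_distr_bigA (fun (k : 'I_n) (j : 'I_D.+1) => (2^-1 : R) ^+ j)) /=.
rewrite -[X in 2 ^+ X](card_ord n) -prodr_const.
apply: ler_prod => k _; rewrite sum_geometric_half_le2 andbT.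
by apply: sumr_ge0 => j _; rewrite exprn_ge0// invr_ge0.
Qed.

Lemma Re_norm_le (z : R[i]) (N : nat) :
  (complex.Re `|z| <= N%:R) = (`|z| <= N%:R).
Proof.
rewrite -[N%:R in RHS](rmorph_nat (real_complex R)).
by rewrite -[`|z| in RHS]RRe_real ?lecR ?normr_real.
Qed.

Lemma Re_norm_ge0 (z : R[i]) : 0 <= complex.Re `|z|.
Proof. by rewrite -ler0c RRe_real ?normr_real. Qed.

(** Each term of a summable family is below the total [E]. Conversely, a radius small against [K]
    reduces summability to the bounded sums of [2^-1 ^+ mdeg l]. *)
Lemma convergentP n (f : pseries R n) : convergent f <-> geometric_growth f.
Proof.
split=> [[rho rho0 sf]|[M [K fMK]]].
  pose E := fine (\esum_(l in [set: multinom n])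
     `|(complex.Re `|f l| * rho ^+ mdeg l)%:E|)%E.
  have leE l : complex.Re `|f l| * rho ^+ mdeg l <= E.
    rewrite -lee_fin /E fineK -?summableE//.
    have := @esum_ge _ _ [set: multinom n]
      (fun l => `|(complex.Re `|f l| * rho ^+ mdeg l)%:E|)%E
      (complex.Re `|f l| * rho ^+ mdeg l)%:E.
    apply; exists [set l]; first by split=> //; exact: finite_set1.
    by rewrite fsbig_set1 /= lee_fin ler_norm.
  exists (Num.bound E), (Num.bound rho^-1) => l.
  rewrite -Re_norm_le natrM natrX -(@ler_pM2r _ (rho ^+ mdeg l)) ?exprn_gt0//.
  apply: (le_trans (leE l)); rewrite -mulrA -exprMn.
  apply: (@le_trans _ _ (Num.bound E)%:R).
    rewrite ltW// archi_boundP// (le_trans _ (leE mnm0))//.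
    by rewrite mulr_ge0 ?Re_norm_ge0// exprn_ge0// ltW.
  rewrite ler_peMr// exprn_ege1//.
  rewrite -(@ler_pM2r _ rho^-1) ?invr_gt0// mulfK ?gt_eqF// mul1r.
  by rewrite ltW// archi_boundP// invr_ge0 ltW.
(* [K.+1] keeps the radius positive when [K] is 0, and the factor 2 makes the ratio at most one
   half. *)
pose rho : R := (2 * K.+1%:R)^-1.
have rho0 : 0 < rho by rewrite invr_gt0 mulr_gt0.
exists rho => //; rewrite /summable.
apply: (@le_lt_trans _ _ (M%:R * 2 ^+ n)%:E); last exact: ltry.
rewrite /esum; apply: ge_ereal_sup => _ [X [finX _] <-].
rewrite fsbig_finite//=; set r : seq (multinom n) := finmap.enum_fset _.
apply: (@le_trans _ _ (\sum_(l <- r) (M%:R * 2^-1 ^+ mdeg l)%:E)%E).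
  apply: lee_sum => l _; rewrite lee_fin ger0_norm; last first.
    by rewrite mulr_ge0 ?Re_norm_ge0// exprn_ge0// ltW.
  apply: (@le_trans _ _ ((M * K ^ mdeg l)%:R * rho ^+ mdeg l)).
    by rewrite ler_wpM2r ?Re_norm_le// exprn_ge0// ltW.
  rewrite natrM natrX -mulrA -exprMn ler_wpM2l//.
  rewrite lerXn2r ?nnegrE ?mulr_ge0 ?invr_ge0//.
  rewrite /rho invfM mulrCA ler_piMr ?invr_ge0//.
  by rewrite ler_pdivrMr// mul1r ler_nat.
rewrite sumEFin lee_fin -mulr_sumr ler_wpM2l//.
by rewrite sum_half_mdeg_le// finmap.fset_uniq.
Qed.

End GeometricGrowth.

(** * Monomial shifts and combinations of binomials *)

Section BinomialCombinations.
Variables (R : realType) (n : nat).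
Local Notation C := R[i].
Local Notation monomial a := (poly_series (mpolyX C a)).

(** Multiplication of a power series by x^a. *)
Definition shift (a : multinom n) (f : pseries R n) : pseries R n :=
  fun l => if lem a l then f (mnm_sub l a) else 0.

Lemma monomialE (a l : multinom n) : monomial a l = (l == a)%:R.
Proof. by rewrite /poly_series mcoeffX eq_sym. Qed.

Lemma shift_is_additive a : {morph shift a : f g / f - g}.
Proof.
move=> f g; apply/funext => l.
by rewrite /shift !fctE; case: ifP => // _; rewrite subr0.
Qed.

HB.instance Definition _ a :=
  GRing.isZmodMorphism.Build (pseries R n) (pseries R n) (shift a)
    (shift_is_additive a).

Lemma shift0 f : shift mnm0 f = f.
Proof.
by apply/funext => l; rewrite /shift subm0 ifT//; apply/mnm_lepP => i; rewrite mnm0E.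
Qed.

Lemma shift_shift a b f : shift a (shift b f) = shift (mnm_add a b) f.
Proof.
apply/funext => l; rewrite /shift submDA.
have [al|nal] := boolP (lem a l); last first.
  rewrite ifN//; apply: contra nal; apply: lepm_trans; exact: lem_addr.
congr (if _ then _ else _); apply/mnm_lepP/mnm_lepP => h i; have := h i;
  by rewrite mnmBE mnmDE leq_subRL// (mnm_lepP al).
Qed.

Lemma shift_monomial a b : shift a (monomial b) = monomial (mnm_add a b).
Proof.
apply/funext => l; rewrite /shift !monomialE; case: ifPn => [al|nal].
  by rewrite -(eqm_add2r a) submK// [mnm_add b a]addmC.
by rewrite (negbTE (_ : l != _))//; apply: contra nal => /eqP ->; exact: lem_addr.
Qed.

Lemma mul_series_binomial f a b :
  mul_series f (poly_series (binomial_of R a b)) = shift a f - shift b f.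
Proof.
have mulX c : mul_series f (monomial c) = shift c f.
  apply/funext => l; rewrite /mul_series /shift; case: ifPn => [cl|ncl].
    have Hk : (mdeg (mnm_sub l c) < (mdeg l).+1)%N by rewrite ltnS mdegB.
    rewrite (bigD1 (BMultinom Hk)) /= ?lem_subr//.
    rewrite monomialE submBA// addmC addmK eqxx mulr1 big1 ?addr0// => k.
    case/andP => kl nk; rewrite monomialE (_ : _ == _ = false) ?mulr0//.
    apply: contra_neqF nk => /eqP E; apply/val_inj => /=.
    by rewrite -E submBA// addmC addmK.
  rewrite big1// => k kl; rewrite monomialE (_ : _ == _ = false) ?mulr0//.
  by apply: contraNF ncl => /eqP <-; exact: lem_subr.
rewrite -!mulX; apply/funext => l; rewrite !fctE /mul_series -sumrB.
by apply: eq_bigr => k _; rewrite -mulrBr /poly_series /binomial_of mcoeffB.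
Qed.

Lemma poly_series_mulX (q : mpoly n C) a :
  poly_series (q * mpolyX C a) = shift a (poly_series q).
Proof.
apply/funext => l; rewrite /poly_series /shift; case: ifPn => [al|nal].
  by rewrite -{1}(submK al) addmC mcoeffMX.
rewrite mcoeffM big1// => k /eqP E; rewrite mcoeffX (_ : _ == _ = false) ?mulr0//.
by apply: contraNF nal => /eqP ->; have := lem_addl k.1 k.2; rewrite -E.
Qed.

Lemma poly_series_is_additive : {morph @poly_series R n : f g / f - g}.
Proof. by move=> f g; apply/funext => l; rewrite /poly_series mcoeffB. Qed.

HB.instance Definition _ :=
  GRing.isZmodMorphism.Build (mpoly n C) (pseries R n) (@poly_series R n)
    poly_series_is_additive.

Variables (p : nat) (alpha beta : 'I_p -> multinom n).

(** The element sum_i q_i h_i. Convergence of the quotients is imposed separately, so that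
    polynomials and germs share this expression. *)
Definition binomial_comb (q : 'I_p -> pseries R n) : pseries R n :=
  \sum_(i < p) (shift (alpha i) (q i) - shift (beta i) (q i)).

Lemma binomial_combD q q' :
  binomial_comb (fun i => q i + q' i) = binomial_comb q + binomial_comb q'.
Proof.
rewrite /binomial_comb -big_split; apply: eq_bigr => i _.
by rewrite !raddfD addrACA.
Qed.

Lemma shift_binomial_comb a q :
  shift a (binomial_comb q) = binomial_comb (fun i => shift a (q i)).
Proof.
rewrite /binomial_comb raddf_sum; apply: eq_bigr => i _.
by rewrite raddfB /= !shift_shift ![mnm_add a _]addmC.
Qed.

Variable h : 'I_p -> mpoly n C.
Hypothesis h_binomial : forall i, h i = binomial_of R (alpha i) (beta i).

Lemma germ_idealE f : germ_ideal h f <->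
  exists2 q, (forall i, convergent (q i)) & f = binomial_comb q.
Proof.
have E q : \sum_(i < p) mul_series (q i) (poly_series (h i)) = binomial_comb q.
  by apply: eq_bigr => i _; rewrite h_binomial mul_series_binomial.
by split=> -[q cq ->]; exists q.
Qed.

Lemma poly_ideal_comb f : poly_ideal h f ->
  exists q : 'I_p -> mpoly n C,
    poly_series f = binomial_comb (fun i => poly_series (q i)).
Proof.
move=> [q ->]; exists q; rewrite raddf_sum; apply: eq_bigr => i _.
by rewrite h_binomial /binomial_of mulrBr raddfB /= !poly_series_mulX.
Qed.

End BinomialCombinations.

(** * Dickson's lemma, weights of exponents and a growth estimate *)

(** Induction on the list of coordinates to be compared. A basis [B0] for the other coordinates
    handles the elements whose coordinate [i] is at least the maximum [T] of that coordinate on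
    [B0]. The rest lie in the finitely many slices [c i = t] with [t < T], and each slice has its
    own basis by induction. *)
Lemma dickson (J : finType) (X : eqType) (c : J -> X -> nat) (A : set X) :
  exists2 B : seq X, {in B, forall b, A b} &
    forall a, A a -> exists2 b, b \in B & forall j, (c j b <= c j a)%N.
Proof.
suff: forall (e : seq J) (A : set X), exists2 B : seq X, {in B, forall b, A b} &
    forall a, A a -> exists2 b, b \in B & {in e, forall j, (c j b <= c j a)%N}.
  move=> /(_ (enum J) A)[B AB BP]; exists B => // a /BP[b bB ba].
  by exists b => // j; apply: ba; rewrite mem_enum.
elim=> [|i e IH] {}A.
  have [[a Aa]|nA] := pselect (exists a, A a); last first.
    by exists [::] => // a Aa; case: nA; exists a.
  exists [:: a]; first by move=> b; rewrite inE => /eqP ->.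
  by move=> a' _; exists a; rewrite ?inE.
have [B0 AB0 B0P] := IH A.
have /choice[Bt BtP] (t : nat) : exists B : seq X,
    {in B, forall b, A b /\ c i b = t} /\
    forall a, A a /\ c i a = t ->
      exists2 b, b \in B & {in e, forall j, (c j b <= c j a)%N}.
  by have [B] := IH [set a | A a /\ c i a = t]; exists B.
pose T := (\max_(b <- B0) c i b)%N.
exists (B0 ++ flatten [seq Bt t | t <- iota 0 T]).
  move=> b; rewrite mem_cat => /orP[/AB0//|/flatten_mapP[t _ /(BtP t).1[]//]].
move=> a Aa; have [aT|aT] := leqP T (c i a).
  have [b bB ba] := B0P a Aa; exists b; first by rewrite mem_cat bB.
  move=> j; rewrite inE => /predU1P[->|/ba//].
  by rewrite (leq_trans _ aT)// /T (big_rem b)//= leq_maxl.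
have [b bB ba] := (BtP (c i a)).2 a (conj Aa erefl).
exists b.
  rewrite mem_cat; apply/orP; right; apply/flatten_mapP; exists (c i a) => //.
  by rewrite mem_iota.
move=> j; rewrite inE => /predU1P[->|/ba//].
by rewrite ((BtP (c i a)).1 b bB).2.
Qed.

Lemma weightD d n (s : 'I_n -> 'rV[int]_d) a b :
  weight s (mnm_add a b) = weight s a + weight s b.
Proof.
by rewrite /weight -big_split; apply: eq_bigr => k _; rewrite mnmDE mulrnDr.
Qed.

Lemma weight0 d n (s : 'I_n -> 'rV[int]_d) : weight s mnm0 = 0.
Proof. by rewrite /weight big1// => k _; rewrite mnm0E mulr0n. Qed.

Lemma weight_mnm1 d n (s : 'I_n -> 'rV[int]_d) k : weight s (mnm1 k) = s k.
Proof.
rewrite /weight (bigD1 k)//= mnm1E eqxx big1 ?addr0// => j /negbTE nj.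
by rewrite mnm1E eq_sym nj.
Qed.

Lemma weight_subK d n (s : 'I_n -> 'rV[int]_d) a l :
  lem a l -> weight s (mnm_sub l a) + weight s a = weight s l.
Proof. by move=> al; rewrite -weightD submK. Qed.

(** Absorbs the polynomial number of exponents in a weight fibre into the geometric rate, since
    [D < 2 ^ D]. *)
Lemma polynomial_le_exponential n M K B D :
  (D.+1 ^ n * (M * K ^ D * (B * D)) <= M * B * (2 ^ n * K * 2) ^ D)%N.
Proof.
rewrite mulnACA mulnCA leq_mul2l; apply/orP; right.
rewrite mulnA !expnMn leq_mul//; last by rewrite ltnW// ltn_expl.
rewrite leq_mul// -expnM mulnC expnM.
by case: n => // n; rewrite leq_exp2r// ltn_expl.
Qed.

(** * Convergent series with zero expansion lie in the ideal *)

Section EffectiveMembership.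
Variables (R : realType) (d n p : nat) (s : 'I_n -> 'rV[int]_d).
Variables (alpha beta : 'I_p -> multinom n).
Local Notation C := R[i].
Local Notation monomial a := (poly_series (mpolyX C a)).

Hypothesis weight_eq0 : forall l, weight s l = 0 -> l = mnm0.
Hypothesis weight_binomial : forall i, weight s (alpha i) = weight s (beta i).
Hypothesis weight_ideal : forall a b, weight s a = weight s b ->
  exists q : 'I_p -> mpoly n C, monomial a - monomial b =
    binomial_comb alpha beta (fun i => poly_series (q i)).

Lemma norm_shift_le a (f : pseries R n) (N : nat) :
  (forall l, `|f l| <= N%:R) -> forall l, `|shift a f l| <= N%:R.
Proof. by move=> fN l; rewrite /shift; case: ifP; rewrite ?normr0. Qed.

Lemma poly_series_bounded (q : 'I_p -> mpoly n C) :
  exists N : nat, forall i l, `|poly_series (q i) l| <= N%:R.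
Proof.
pose e i l := Num.bound (complex.Re `|poly_series (q i) l|).
exists (\sum_(i < p) \sum_(l <- msupp (q i)) e i l)%N => i l.
rewrite -Re_norm_le; have [lq|lq] := boolP (l \in msupp (q i)); last first.
  by rewrite /poly_series (memN_msupp_eq0 lq) normr0.
apply: (@le_trans _ _ (e i l)%:R); first by rewrite ltW// archi_boundP// Re_norm_ge0.
by rewrite ler_nat (bigD1 i)//= (big_rem l)//= -addnA leq_addr.
Qed.

(* The pairs of exponents of equal weight form a monoid which is finitely
   generated by Dickson's lemma; an expression of [x^a - x^b] in the ideal is
   assembled from expressions for the generators, and its size grows linearly. *)
Lemma weight_ideal_bounded : exists B : nat, forall l l',
  weight s l = weight s l' -> (mdeg l' <= B * mdeg l)%N /\
  exists2 q : 'I_p -> pseries R n,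
    (forall i c, `|q i c| <= (B * mdeg l)%:R) &
    monomial l - monomial l' = binomial_comb alpha beta q.
Proof.
(* The condition on [x.1] makes the subtraction of a generator lower the degree of [l], on which the
   induction runs. *)
pose A := [set x : multinom n * multinom n |
  weight s x.1 = weight s x.2 /\ x.1 != mnm0].
have [G AG GP] := @dickson ('I_n + 'I_n)%type (multinom n * multinom n)%type
  (fun j x => match j with inl i => x.1 i | inr i => x.2 i end) A.
have /choice[N NP] (x : multinom n * multinom n) : exists N : nat,
    weight s x.1 = weight s x.2 -> exists2 q : 'I_p -> pseries R n,
    (forall i c, `|q i c| <= N%:R) &
    monomial x.1 - monomial x.2 = binomial_comb alpha beta q.
  have [E|nE] := pselect (weight s x.1 = weight s x.2); last by exists 0%N.
  have [q qE] := weight_ideal E; have [N qN] := poly_series_bounded q.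
  by exists N => _; exists (fun i => poly_series (q i)).
(* One constant serves both claims: the degree of the second exponent and the size of the
   quotients. *)
pose B := (\max_(x <- G) (N x + mdeg x.2))%N; exists B.
have GB x : x \in G -> (N x + mdeg x.2 <= B)%N.
  by move=> xG; rewrite /B (big_rem x)//= leq_maxl.
move=> l; have [m] := ubnP (mdeg l); elim: m l => // m IH l lm l' E.
have [l0|l0] := eqVneq l mnm0.
  have -> : l' = mnm0 by apply: weight_eq0; rewrite -E l0 weight0.
  rewrite l0 mdeg0 muln0; split=> //; exists (fun=> 0) => [i c|].
    by rewrite (_ : (0 : pseries R n) c = 0)// normr0.
  by rewrite subrr /binomial_comb big1// => i _; rewrite !raddf0 addr0.
have [[a b] abG ab] := GP (l, l') (conj E l0).
have [Eab /= a0] := AG _ abG.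
have al : lem a l by apply/mnm_lepP => i; exact: (ab (inl i)).
have bl' : lem b l' by apply/mnm_lepP => i; exact: (ab (inr i)).
have dl : mdeg l = (mdeg (mnm_sub l a) + mdeg a)%N by rewrite -mdegD submK.
have a1 : (0 < mdeg a)%N by rewrite lt0n mdeg_eq0.
have lam : (mdeg (mnm_sub l a) < m)%N.
  by rewrite -ltnS (leq_trans _ lm)// ltnS dl -addn1 leq_add2l.
have E1 : weight s (mnm_sub l a) = weight s (mnm_sub l' b).
  by apply: (addIr (weight s a)); rewrite {2}Eab !weight_subK.
have [deg1 [q1 q1B q1E]] := IH _ lam _ E1.
have [q2 q2B q2E] := NP (a, b) Eab.
have NB := GB _ abG.
have step : (B * mdeg (mnm_sub l a) + B <= B * mdeg l)%N.
  by rewrite dl mulnDr leq_add2l leq_pmulr.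
split.
  rewrite -[in leqLHS](submK bl') mdegD (leq_trans _ step)// leq_add//.
  by rewrite (leq_trans _ NB)// leq_addl.
(* This is x^l - x^l' = x^(l-a) (x^a - x^b) + x^b (x^(l-a) - x^(l'-b)). *)
exists (fun i => shift (mnm_sub l a) (q2 i) + shift b (q1 i)).
  move=> i c; apply: le_trans (ler_normD _ _) _.
  apply: (@le_trans _ _ ((N (a, b))%:R + (B * mdeg (mnm_sub l a))%:R)).
    by rewrite lerD// norm_shift_le.
  rewrite -natrD ler_nat (leq_trans _ step)// addnC leq_add2l.
  by rewrite (leq_trans _ NB)// leq_addr.
rewrite binomial_combD -!shift_binomial_comb -q1E -q2E /= !raddfB /=.
rewrite !shift_monomial submK// ![mnm_add b _]addmC !submK//.
by rewrite addrA subrK.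
Qed.

(** A degree bound makes the fibre finite, so the sum can be handled as a big operator over a finite
    type. *)
Lemma fsum_fiber (V : nmodType) w D (F : multinom n -> V) :
  (forall l, weight s l = w -> (mdeg l <= D)%N) ->
  \sum_(l \in [set l | weight s l = w]) F l =
  \sum_(b : bmultinom n D.+1 | weight s b == w) F b.
Proof.
move=> wD.
pose r := [seq bmnm b |
  b : bmultinom n D.+1 <- enum {: bmultinom n D.+1} & weight s b == w].
rewrite (fsbigE r); first last.
- move=> l /= lw; case/negP; apply/mapP.
  have lD : (mdeg l < D.+1)%N by rewrite ltnS wD.
  by exists (BMultinom lD); rewrite // mem_filter /= lw eqxx mem_enum.
- by move=> _ /mapP[b + ->]; rewrite mem_filter => /andP[/eqP].
- by rewrite map_inj_uniq ?filter_uniq -?enumT ?enum_uniq// => b b' /val_inj.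
rewrite big_map big_filter_cond big_enum_cond /=; apply: eq_bigl => b.
by apply: andb_idr => /eqP bw; exact: mem_set.
Qed.

Lemma card_bmultinom_le D : (#|{: bmultinom n D}| <= D ^ n)%N.
Proof.
case: D => [|D]; first by rewrite eq_card0// => -[].
pose f (b : bmultinom n D.+1) : {ffun 'I_n -> 'I_D.+1} := [ffun k => inord (b k)].
have fE b k : f b k = b k :> nat.
  rewrite ffunE inordK//; apply: leq_ltn_trans (bmdeg b).
  by rewrite mdegE (bigD1 k)//= leq_addr.
have -> : (D.+1 ^ n)%N = #|{: {ffun 'I_n -> 'I_D.+1}}|.
  by rewrite card_ffun !card_ord.
apply: (@leq_card _ _ f) => b b' E; apply: val_inj; apply/mnmP => k.
by rewrite /= -!fE E.
Qed.

(** The coefficients of [g] on each weight fibre sum to zero, so [g] is the sum of the g_l (x^l -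
    x^ref), where [ref] is a fixed exponent of the same weight. The bounded quotients of these
    differences are then added up. *)
Lemma expansion_eq0_mem (g : pseries R n) :
  convergent g -> expansion s g = (fun=> 0) ->
  exists2 q, (forall i, convergent (q i)) & g = binomial_comb alpha beta q.
Proof.
move=> /convergentP[M [K gMK]] g0.
have [B BP] := weight_ideal_bounded.
(* The default [mnm0] is reached only at weights that no exponent has. *)
pose ref w : multinom n := xget mnm0 [set l | weight s l = w].
have refP l : weight s l = weight s (ref (weight s l)).
  by apply/esym; exact: (xgetI mnm0 (erefl : [set l' | weight s l' = weight s l] l)).
have /choice[q0 q0P] l : exists q : 'I_p -> pseries R n,
    (forall i c, `|q i c| <= (B * mdeg l)%:R) /\
    monomial l - monomial (ref (weight s l)) = binomial_comb alpha beta q.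
  by have [_ [q qB qE]] := BP _ _ (refP l); exists q.
(* Only those [l] whose weight is that of x^c times x^(alpha i) contribute. Other homogeneous
   components of [q0 l] are discarded, which makes every coefficient a finite sum. *)
pose q i : pseries R n := fun c =>
  \sum_(l \in [set l | weight s l = weight s (mnm_add c (alpha i))])
    g l * q0 l i c.
have deg_fiber x l : weight s l = weight s x -> (mdeg l <= B * mdeg x)%N.
  by move=> E; exact: (BP _ _ (esym E)).1.
exists q => [i|].
  (* The sum has at most [D.+1 ^ n] terms of size at most [M * K.+1 ^ D * (B * D)]. The resulting
     [L ^ D] splits along [D = B * (mdeg c + mdeg (alpha i))] into the two constants given next. *)
  apply/convergentP; pose L := (2 ^ n * K.+1 * 2)%N.
  exists (M * B * L ^ (B * mdeg (alpha i)))%N, (L ^ B)%N => c.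
  set x := mnm_add c (alpha i); pose D := (B * mdeg x)%N.
  rewrite /q (fsum_fiber _ (@deg_fiber x)) -/D.
  apply: (@le_trans _ _ (D.+1 ^ n * (M * K.+1 ^ D * (B * D)))%:R); last first.
    rewrite ler_nat -[leqRHS]mulnA -expnM -expnD -mulnDr addnC -mdegD -/x -/D.
    exact: polynomial_le_exponential.
  apply: le_trans (ler_norm_sum _ _ _) _.
  apply: (@le_trans _ _ (\sum_(b : bmultinom n D.+1) (M * K.+1 ^ D * (B * D))%:R)).
    rewrite big_mkcond; apply: ler_sum => b _; case: ifP => [_|_]; last exact: ler0n.
    have bD : (mdeg b <= D)%N by rewrite -ltnS bmdeg.
    rewrite normrM natrM ler_pM//.
      apply: le_trans (gMK b) _; rewrite ler_nat leq_mul2l; apply/orP; right.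
      apply: (@leq_trans (K.+1 ^ mdeg b)); last by rewrite leq_pexp2l.
      by case: (mdeg b) => // e; rewrite leq_exp2r.
    apply: le_trans ((q0P b).1 i c) _.
    by rewrite ler_nat leq_mul2l bD orbT.
  rewrite sumr_const -[leLHS]mulr_natl -natrM ler_nat leq_mul2r.
  by rewrite card_bmultinom_le orbT.
apply/funext => x; pose w := weight s x; pose D := (B * mdeg x)%N.
(* As [alpha i] and [beta i] have equal weight, both shifts of [q i] sum over the fibre of [x]
   itself. *)
have sumE a i : weight s a = weight s (alpha i) ->
    shift a (q i) x =
    \sum_(b : bmultinom n D.+1 | weight s b == w) g b * shift a (q0 b i) x.
  move=> E; rewrite /shift; case: ifPn => [al|_]; last first.
    by rewrite big1// => *; rewrite mulr0.
  by rewrite /q weightD -E weight_subK// (fsum_fiber _ (@deg_fiber x)).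
rewrite /binomial_comb fct_sumE.
have -> : \sum_(i < p) (shift (alpha i) (q i) - shift (beta i) (q i)) x =
    \sum_(b : bmultinom n D.+1 | weight s b == w)
      g b * binomial_comb alpha beta (q0 b) x.
  under [RHS]eq_bigr do rewrite /binomial_comb fct_sumE mulr_sumr.
  rewrite exchange_big; apply: eq_bigr => i _ /=.
  rewrite !fctE !sumE//; under [RHS]eq_bigr do rewrite mulrBr.
  by rewrite sumrB.
have -> : g x = \sum_(b : bmultinom n D.+1 | weight s b == w) g b * (x == b)%:R.
  have xD : (mdeg x < D.+1)%N by rewrite ltnS deg_fiber.
  rewrite (bigD1 (BMultinom xD)) //= eqxx mulr1 big1 ?addr0// => b /andP[_ nb].
  rewrite (_ : _ == _ = false) ?mulr0//; apply: contraNF nb => /eqP xb.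
  by apply/eqP/val_inj/esym.
(* The zero fibre sum allows subtracting the coefficient of x^ref for free, which turns each
   monomial x^b into x^b - x^ref. *)
have gw : (\sum_(b : bmultinom n D.+1 | weight s b == w) g b) * (x == ref w)%:R = 0.
  rewrite -(fsum_fiber _ (@deg_fiber x)).
  have := congr1 (fun f => f w) g0; rewrite /expansion => ->.
  by rewrite mul0r.
rewrite -[LHS]subr0 -[X in _ - X]gw mulr_suml -sumrB.
apply: eq_bigr => b /eqP bw; rewrite -(q0P b).2 bw.
by rewrite -!(monomialE R) -mulrBr.
Qed.

End EffectiveMembership.

(** * Closure properties of convergent series *)

Section ConvergentSeries.
Variables (R : realType) (n : nat).
Implicit Types f g : pseries R n.

Lemma pseriesDE f g l : (f + g) l = f l + g l. Proof. by []. Qed.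

Lemma pseriesBE f g l : (f - g) l = f l - g l. Proof. by []. Qed.

Lemma convergent_le f g :
  (forall l, `|f l| <= `|g l|) -> convergent g -> convergent f.
Proof.
move=> fg /convergentP[M [K gMK]]; apply/convergentP.
by exists M, K => l; exact: le_trans (fg l) (gMK l).
Qed.

Lemma convergentD f g : convergent f -> convergent g -> convergent (f + g).
Proof.
move=> /convergentP[M [K fMK]] /convergentP[M' [K' gMK]]; apply/convergentP.
exists (M + M')%N, (K + K')%N => l; apply: le_trans (ler_normD _ _) _.
apply: le_trans (lerD (fMK l) (gMK l)) _; rewrite -natrD ler_nat mulnDl.
case: (mdeg l) => // e.
by rewrite leq_add// leq_mul// leq_exp2r// ?leq_addr ?leq_addl.
Qed.

Lemma convergent0 : convergent (0 : pseries R n).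
Proof.
apply/convergentP; exists 0%N, 0%N => l.
by rewrite (_ : (0 : pseries R n) l = 0)// normr0.
Qed.

Lemma convergentN f : convergent f -> convergent (- f).
Proof. by apply: convergent_le => l; rewrite [(- f) l]/(- _) normrN. Qed.

(* The quotient by [1 - x^b] is the sum of the shifts of [f] by multiples of
   [b]; at the index [l] it may be truncated after [mdeg l] terms. *)
Lemma convergent_div_1sub b f : b != mnm0 -> convergent f ->
  exists2 q, convergent q & f = q - shift b q.
Proof.
move=> b0 /convergentP[M [K fMK]].
pose Q := fix Q (N : nat) : pseries R n :=
  if N is N'.+1 then f + shift b (Q N') else f.
have QS N : Q N.+1 = f + shift b (Q N) by [].
have b1 : (0 < mdeg b)%N by rewrite lt0n mdeg_eq0.
have degB l : lem b l -> (mdeg (mnm_sub l b) < mdeg l)%N.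
  move=> bl; rewrite -[ltnRHS](congr1 mdeg (submK bl)) mdegD.
  by rewrite -[ltnLHS]addn0 ltn_add2l.
have Qstable m N l : (mdeg l <= m)%N -> (m <= N)%N -> Q m l = Q N l.
  elim: m N l => [|m IH] [|N] l lm mN //; rewrite !QS.
    rewrite pseriesDE /shift; case: ifP => [/degB|_]; last by rewrite addr0.
    by rewrite ltnNge (leq_trans lm).
  rewrite !pseriesDE /shift; case: ifP => // /degB bl.
  by rewrite (IH N)// -ltnS (leq_trans bl).
exists (fun l => Q (mdeg l) l).
  (* The factor 2 pays for the number of terms: [N.+1 <= 2 ^ N] at [N = mdeg l]. *)
  apply/convergentP; exists M, (2 * K.+1)%N => l.
  have QM N : `|Q N l| <= (N.+1 * (M * K.+1 ^ mdeg l))%:R.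
    elim: N l => [|N IH] l.
      apply: le_trans (fMK l) _; rewrite mul1n ler_nat leq_mul2l.
      by case: (mdeg l) => [|e]; rewrite ?leqnn ?leq_exp2r// ?leqnSn orbT.
    rewrite QS; apply: le_trans (ler_normD _ _) _; rewrite mulSn natrD lerD//.
      apply: le_trans (fMK l) _; rewrite ler_nat leq_mul2l.
      by case: (mdeg l) => [|e]; rewrite ?leqnn ?leq_exp2r// ?leqnSn orbT.
    rewrite /shift; case: ifP => [/degB bl|_]; last by rewrite normr0.
    apply: le_trans (IH _) _; rewrite ler_nat !leq_mul2l.
    by rewrite leq_pexp2l ?orbT// ltnW.
  apply: le_trans (QM _) _; rewrite ler_nat expnMn mulnCA leq_mul2l leq_mul2r.
  by rewrite ltn_expl ?orbT.
apply/funext => l; rewrite pseriesBE (Qstable _ (mdeg l).+1)// QS.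
rewrite pseriesDE /shift; case: ifP => [/degB bl|_]; last by rewrite addr0 subr0.
by rewrite (Qstable _ (mdeg l) (mnm_sub l b)) ?addrK// ltnW.
Qed.

End ConvergentSeries.

(** * Binomials that are units at the origin *)

Section UnitBinomial.
Variables (R : realType) (n p : nat) (alpha beta : 'I_p -> multinom n).

(** Exactly one of the two monomials is 1, so the binomial is 1 - x^b up to sign, with [b] nonzero,
    and can be divided by; all other quotients are 0. *)
Lemma convergent_comb_unit i f :
  (alpha i == mnm0) != (beta i == mnm0) -> convergent f ->
  exists2 q : 'I_p -> pseries R n, (forall j, convergent (q j)) &
    f = binomial_comb alpha beta q.
Proof.
move=> unit_i cf.
suff [q cq ->] : exists2 q : pseries R n, convergent q &
    f = shift (alpha i) q - shift (beta i) q.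
  exists (fun j => if j == i then q else 0) => [j|].
    by case: ifP => // _; exact: convergent0.
  rewrite /binomial_comb (bigD1 i)//= eqxx big1 ?addr0// => j /negbTE ->.
  by rewrite !raddf0 addr0.
move: unit_i; have [->|a0] := eqVneq (alpha i) mnm0.
  have [//|b0 _] := eqVneq (beta i) mnm0.
  by have [q cq ->] := convergent_div_1sub b0 cf; exists q; rewrite ?shift0.
have [-> _|//] := eqVneq (beta i) mnm0.
have [q cq ->] := convergent_div_1sub a0 cf; exists (- q).
  exact: convergentN.
by rewrite shift0 raddfN opprK addrC.
Qed.

End UnitBinomial.

(** * The pairing, orders, and the kernel on differences of monomials *)

Section Pairing.
Variables (R : realType) (d : nat).
Implicit Types x y : 'rV[R]_d.

Lemma pairing_sumZl q (c : 'I_q -> R) (x : 'I_q -> 'rV[R]_d) y :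
  pairing (\sum_(i < q) c i *: x i) y = \sum_(i < q) c i * pairing (x i) y.
Proof.
rewrite /pairing; under eq_bigr do rewrite summxE mulr_suml.
rewrite exchange_big; apply: eq_bigr => i _; rewrite mulr_sumr.
by apply: eq_bigr => k _; rewrite mxE mulrA.
Qed.

Lemma pairing_toRB (a b : 'rV[int]_d) y :
  pairing (toR R (a - b)) y = pairing (toR R a) y - pairing (toR R b) y.
Proof.
rewrite /pairing -sumrB; apply: eq_bigr => i _.
by rewrite !mxE rmorphB /= mulrBl.
Qed.

Lemma pairing_delta i y : pairing (toR R (delta_mx 0 i)) y = y 0 i.
Proof.
rewrite /pairing (bigD1 i)//= !mxE !eqxx mul1r big1 ?addr0// => j /negbTE ji.
by rewrite !mxE ji andbF mul0r.
Qed.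

(** The reason the monomial valuation at [theta y] gives x^l the value that [y] gives to its
    image. *)
Lemma pairing_weight n (s : 'I_n -> 'rV[int]_d) l y :
  pairing (toR R (weight s l)) y = \sum_(k < n) (l k)%:R * theta R s y 0 k.
Proof.
have -> : toR R (weight s l) = \sum_(k < n) (l k)%:R *: toR R (s k).
  rewrite /toR /weight map_mx_sum; apply: eq_bigr => k _.
  by apply/rowP => i; rewrite !mxE mulmxnE raddfMn mulr_natl.
by rewrite pairing_sumZl; apply: eq_bigr => k _; rewrite mxE.
Qed.

Lemma theta_linear n (s : 'I_n -> 'rV[int]_d) : linear (theta R s).
Proof.
move=> c x y; apply/rowP => k; rewrite !mxE /pairing mulr_sumr -big_split.
by apply: eq_bigr => i _; rewrite !mxE mulrDr mulrCA.
Qed.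

Lemma additive_pairing (F : {additive 'rV[int]_d -> R}) m :
  F m = pairing (toR R m) (\row_i F (delta_mx 0 i)).
Proof.
rewrite {1}(row_sum_delta m) raddf_sum; apply: eq_bigr => i _.
by rewrite -[m 0 i]intz scaler_int raddfMz !mxE mulrzl.
Qed.

End Pairing.

Lemma order_of_geP (R : realType) (I : Type) (w : I -> R) (a : I -> R[i]) (v : R) :
  (v%:E <= order_of w a)%E <-> forall i, a i != 0 -> v <= w i.
Proof.
split=> [/ereal_infP va i ai|va].
  by rewrite -lee_fin; apply: va; exists i.
by apply/ereal_infP => _ [i /va vi <-]; rewrite lee_fin.
Qed.

(** The image of x^a - x^b is the difference of two characters. This translates the hypothesis on
    the kernel into statements about exponents. *)
Lemma ker_eps_monomials (R : realType) d n (s : 'I_n -> 'rV[int]_d) a b :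
  ker_eps R s (mpolyX R[i] a - mpolyX R[i] b) <-> weight s a = weight s b.
Proof.
have E m : expansion s (poly_series (mpolyX R[i] a - mpolyX R[i] b)) m =
    (weight s a == m)%:R - (weight s b == m)%:R.
  rewrite /expansion; under eq_fsbigr do rewrite /poly_series mcoeffB !mcoeffX.
  (* The list [[:: a; b]] used below must be duplicate-free. *)
  have [->|ab] := eqVneq a b; first by rewrite subrr fsbig1// => l _; rewrite subrr.
  rewrite fsbig_mkcond (fsbigE [:: a; b]) //=; last 2 first.
  - by rewrite inE ab.
  - move=> l _; rewrite !inE negb_or /patch => /andP[la lb].
    by rewrite !(eq_sym _ l) (negbTE la) (negbTE lb) subrr if_same.
  rewrite !big_cons big_nil !in_setT /patch addr0 !eqxx.
  have inW l : (l \in [set l | weight s l = m]) = (weight s l == m).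
    by apply/idP/eqP => [/set_mem//|lm]; exact: mem_set.
  rewrite !inW (eq_sym b a) (negbTE ab) subr0 sub0r.
  by do 2!case: ifP => _; rewrite /= ?mulr0n ?addr0 ?add0r ?oppr0 ?addr0.
split=> [/(_ (weight s a))|ab m]; last by rewrite E ab subrr.
rewrite E eqxx => /eqP; rewrite subr_eq0.
by have [->//|_] := eqVneq (weight s b) (weight s a); rewrite oner_eq0.
Qed.

(** * The isomorphism of cones and the equality of the filtrations *)

Section ToricCompleteIntersection.
Variables (R : realType) (d n p : nat) (S : set 'rV[int]_d).
Variables (s : 'I_n -> 'rV[int]_d) (alpha beta : 'I_p -> multinom n).
Variable h : 'I_p -> mpoly n R[i].
Hypothesis S_generated : S = range (weight s).
Hypothesis S_spans :
  forall m : 'rV[int]_d, exists a b, [/\ S a, S b & m = a - b].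
Hypothesis h_binomial : forall i, h i = binomial_of R (alpha i) (beta i).
Hypothesis ker_eps_h : ker_eps R s = poly_ideal h.

Lemma weight_binomial i : weight s (alpha i) = weight s (beta i).
Proof.
apply/(ker_eps_monomials R).
rewrite -[_ - _]/(binomial_of _ _ _) -h_binomial ker_eps_h.
exists (fun j => (j == i)%:R); rewrite (bigD1 i)//= eqxx mul1r big1 ?addr0//.
by move=> j /negbTE ->; rewrite mul0r.
Qed.

(* Evaluating [x^a - x^b = \sum_i q_i h_i] at [x_k = exp mu_k] kills the
   right-hand side. *)
Lemma weight_eq_pairing (mu : 'rV[R]_n) a b : tau_star R alpha beta mu ->
  weight s a = weight s b ->
  \sum_(k < n) (a k)%:R * mu 0 k = \sum_(k < n) (b k)%:R * mu 0 k.
Proof.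
move=> [_ tau_mu] /(ker_eps_monomials R); rewrite ker_eps_h => -[q].
pose v k := real_complex R (sequences.expR (mu 0 k)).
have vX l : meval v (mpolyX R[i] l) =
    real_complex R (sequences.expR (\sum_(k < n) (l k)%:R * mu 0 k)).
  rewrite mevalX exp.expR_sum rmorph_prod; apply: eq_bigr => k _.
  by rewrite /v -rmorphXn exp.expRM_natl.
move/(congr1 (meval v)); rewrite rmorph_sum big1 => [/eqP|i _]; last first.
  rewrite rmorphM /= h_binomial mevalB !vX.
  have -> : \sum_(k < n) (alpha i k)%:R * mu 0 k =
      \sum_(k < n) (beta i k)%:R * mu 0 k.
    apply/eqP; rewrite -subr_eq0 -sumrB -[eqbRHS](tau_mu i); apply/eqP.
    by apply: eq_bigr => k _; rewrite mulrBl.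
  by rewrite subrr mulr0.
by rewrite mevalB !vX subr_eq0 => /eqP/complexI/exp.expR_inj.
Qed.

(** Injectivity holds because differences of weights fill the lattice. For surjectivity, [mu]
    induces an additive map on the lattice, and the vector representing it is the preimage. *)
Lemma theta_iso :
  cone_iso (dual_cone (cone_of R S)) (tau_star R alpha beta) (theta R s).
Proof.
split; first exact: theta_linear.
have wS l : S (weight s l) by rewrite S_generated; exists l.
have spanw m : exists ab : multinom n * multinom n,
    m = weight s ab.1 - weight s ab.2.
  have [a [b]] := S_spans m; rewrite S_generated.
  by move=> [[l _ <-] [l' _ <-] ->]; exists (l, l').
split=> [y sy|y y' _ _ yy'|mu tau_mu].
- split=> [k|i].
    rewrite mxE; apply: sy; exists 1%N, (fun=> 1), (fun=> s k).
    split=> [_|]; first by split; rewrite // -weight_mnm1.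
    by rewrite big_ord1 scale1r.
  under eq_bigr do rewrite mulrBl.
  by rewrite sumrB -!pairing_weight weight_binomial subrr.
- apply/rowP => i; have [[a b] E] := spanw (delta_mx 0 i).
  by rewrite -!pairing_delta E !pairing_toRB !pairing_weight yy'.
have /choice[ab abP] := spanw.
pose L (l : multinom n) := \sum_(k < n) (l k)%:R * mu 0 k.
have LD a b : L (mnm_add a b) = L a + L b.
  by rewrite /L -big_split; apply: eq_bigr => k _; rewrite mnmDE natrD mulrDl.
(* [ab] is an arbitrary choice of presentation; [FE] shows that the value does not depend on it, and
   additivity follows. *)
pose F m := L (ab m).1 - L (ab m).2.
have FE m a b : m = weight s a - weight s b -> F m = L a - L b.
  move=> mE; apply/eqP; rewrite subr_eq addrAC eq_sym subr_eq -!LD; apply/eqP.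
  apply: weight_eq_pairing => //; rewrite !weightD.
  by apply/eqP; rewrite -subr_eq addrAC eq_sym -subr_eq -abP mE.
have FB : {morph F : m m' / m - m'}.
  move=> m m'.
  rewrite (FE _ (mnm_add (ab m).1 (ab m').2) (mnm_add (ab m).2 (ab m').1)).
    by rewrite !LD /F [in LHS]opprD addrACA opprB.
  rewrite !weightD [in LHS](abP m) [in LHS](abP m').
  by rewrite [in RHS]opprD [RHS]addrACA opprB.
pose F' : {additive 'rV[int]_d -> R} :=
  HB.pack F (GRing.isZmodMorphism.Build _ _ F FB).
pose y : 'rV[R]_d := \row_i F (delta_mx 0 i).
have yL l : pairing (toR R (weight s l)) y = L l.
  rewrite -(additive_pairing F') /= (FE _ l mnm0) ?weight0 ?subr0//.
  by rewrite /L [X in _ - X]big1 ?subr0// => k _; rewrite mnm0E mul0r.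
exists y.
  move=> _ [q [c [m [cm ->]]]]; rewrite pairing_sumZl; apply: sumr_ge0 => i _.
  have [ci] := cm i; rewrite S_generated => -[l _ <-]; rewrite mulr_ge0// yL.
  by apply: sumr_ge0 => k _; rewrite mulr_ge0//; exact: tau_mu.1.
apply/rowP => k; rewrite mxE -weight_mnm1 yL /L (bigD1 k)//= mnm1E eqxx mul1r.
by rewrite big1 ?addr0// => j /negbTE jk; rewrite mnm1E eq_sym jk mul0r.
Qed.

Hypothesis S_pointed : forall m : 'rV[int]_d, S m -> S (- m) -> m = 0.

(** If x_k divided x^l, then - s_k would be the weight of the cofactor, so both s_k and - s_k would
    lie in [S]. *)
Lemma weight_pointed l : (forall k, s k != 0) -> weight s l = 0 -> l = mnm0.
Proof.
move=> s0 wl0; apply/mnmP => k; rewrite mnm0E; apply/eqP; apply: contraT => lk.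
have kl : lem (mnm1 k) l by rewrite lep1mP.
have /eqP := s0 k; case; apply: S_pointed; rewrite S_generated.
  by exists (mnm1 k) => //; exact: weight_mnm1.
exists (mnm_sub l (mnm1 k)) => //; apply/eqP.
by rewrite -addr_eq0 -(weight_mnm1 s) weight_subK// wl0.
Qed.

(* If some [s k] vanishes then the origin is not on [V]: one of the [h i] is a
   unit at the origin, and the ideal of germs is the whole ring. *)
Lemma expansion_ker (g : pseries R n) :
  convergent g -> expansion s g = (fun=> 0) -> germ_ideal h g.
Proof.
move=> cg g0; apply/(germ_idealE h_binomial).
have [s0|] := pselect (forall k, s k != 0).
  apply: (expansion_eq0_mem (s := s)) => //.
  - by move=> l; exact: weight_pointed.
  - exact: weight_binomial.
  - move=> a b /(ker_eps_monomials R); rewrite ker_eps_h => /poly_ideal_comb.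
    by move=> /(_ _ _ h_binomial)[q qE]; exists q; rewrite -qE raddfB.
move=> /existsNP[k /negP]; rewrite negbK => /eqP sk0.
have : poly_ideal h (mpolyX R[i] (mnm1 k) - mpolyX R[i] mnm0).
  by rewrite -ker_eps_h; apply/ker_eps_monomials; rewrite weight_mnm1 weight0.
move=> [q /(congr1 (mcoeff mnm0))]; rewrite raddf_sum => qE.
(* The kernel element x_k - 1 has constant coefficient -1. Were no binomial a unit, every [h i],
   hence every element of the ideal, would have constant coefficient 0. *)
have [i ui] : exists i, (alpha i == mnm0) != (beta i == mnm0).
  apply/not_existsP => nu; move: qE; rewrite big1 => [|i _].
    rewrite mcoeffB !mcoeffX eqxx mnm1_eq0 sub0r => /eqP.
    by rewrite oppr_eq0 oner_eq0.
  rewrite /= rmorphM /= h_binomial mcoeffB !mcoeffX.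
  by have /negP := nu i; rewrite negbK => /eqP ->; rewrite subrr mulr0.
exact: (convergent_comb_unit ui).
Qed.

Lemma K_toric_embedded r (nu : 'I_r -> 'rV[R]_d) v :
  K_toric s h nu v = K_embedded h (fun j => theta R s (nu j)) v.
Proof.
apply/seteqP; split=> _ [a [b [[ca va] hb ->]]]; last first.
  exists a, b; split=> //; split=> // j; apply/order_of_geP => m am0.
  (* A nonzero sum over the fibre has a nonzero term. *)
  have [l lm al0] : exists2 l, weight s l = m & a l != 0.
    apply: contrapT => nal; case/negP: am0; apply/eqP; apply: fsbig1 => l lm.
    by apply/eqP; apply: contrapT => /negP al0; apply: nal; exists l.
  by rewrite -lm pairing_weight; have /order_of_geP/(_ l al0) := va j.
(* [e] marks the exponents whose whole fibre cancels: [a1] is the dropped part and [a2] what is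
   left. *)
pose e l := expansion s a (weight s l) == 0.
pose a1 : pseries R n := fun l => if e l then a l else 0.
pose a2 : pseries R n := fun l => if e l then 0 else a l.
have aE : a = a2 + a1.
  apply/funext => l; rewrite pseriesDE /a1 /a2.
  by case: ifP => _; rewrite ?add0r ?addr0.
exists a2, (a1 + b); split; last by rewrite addrA -aE.
  split.
    by apply: convergent_le ca => l; rewrite /a2; case: ifP; rewrite ?normr0.
  move=> j; apply/order_of_geP => l; rewrite /a2 -pairing_weight.
  case: ifPn => [_|el _]; first by rewrite eqxx.
  by have /order_of_geP/(_ _ el) := va j.
have a1h : germ_ideal h a1.
  apply: expansion_ker.
    by apply: convergent_le ca => l; rewrite /a1; case: ifP; rewrite ?normr0.
  apply/funext => m; rewrite /expansion.
  (* On each fibre [a1] is either all of [a], with sum zero, or identically zero. *)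
  have [em|em] := eqVneq (expansion s a m) 0.
    rewrite -[RHS]em; apply: eq_fsbigr => l; rewrite inE /= => lm.
    by rewrite /a1 /e lm em eqxx.
  by apply: fsbig1 => l lm; rewrite /a1 /e lm (negbTE em).
move: a1h hb => /(germ_idealE h_binomial)[q cq ->].
move=> /(germ_idealE h_binomial)[q' cq' ->].
apply/(germ_idealE h_binomial); exists (fun i => q i + q' i).
  by move=> i; exact: convergentD.
by rewrite binomial_combD.
Qed.

End ToricCompleteIntersection.

Theorem theorem6 (R : realType) (d p : nat) (S : set 'rV[int]_d)
  (s : 'I_(d + p) -> 'rV[int]_d) (alpha beta : 'I_p -> multinom (d + p))
  (h : 'I_p -> mpoly (d + p) R[i])
  (S_generated : S = range (weight s))
  (S_spans : forall m : 'rV[int]_d, exists a b, [/\ S a, S b & m = a - b])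
  (S_pointed : forall m : 'rV[int]_d, S m -> S (- m) -> m = 0)
  (S_saturated : S = [set m | cone_of R S (toR R m)])
  (h_binomial : forall i, h i = binomial_of R (alpha i) (beta i))
  (V_complete_intersection : ker_eps R s = poly_ideal h)
  (no_common_variable : forall i k, alpha i k = 0%N \/ beta i k = 0%N) :
  let sigma := dual_cone (cone_of R S) in
  let tau := tau_star R alpha beta in
  cone_iso sigma tau (theta R s) /\
  forall (r : nat) (nu : 'I_r -> 'rV[int]_d),
    (0 < r)%N ->
    (forall j, primitive (nu j) /\ sigma (toR R (nu j))) ->
    let nuR := fun j => toR R (nu j) in
    let mu := fun j => theta R s (nuR j) in
    poincare_defined (K_toric s h nuR) ->
    poincare_defined (K_embedded h mu) ->
    poincare (K_toric s h nuR) = poincare (K_embedded h mu).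
Proof.
split; first exact: (theta_iso S_generated S_spans h_binomial).
move=> r nu _ _ nuR mu _ _; congr poincare; apply/funext => v.
exact: (K_toric_embedded S_generated h_binomial).
Qed.
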